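(* Let $\alpha\in\mathbb{Q}$ and $\beta>0$. Then $F(\alpha,\beta)=\{(j,k)\in\mathbb{Z}^2:|k-j\alpha|<\beta\}$ has Property A, i.e. $\mathfrak{T}_2^{p}(F-F)=\mathfrak{U}_2(F)$ for $F=F(\alpha,\beta)$.
   Context: $T=\mathbb{R}/\mathbb{Z}$, $e_{j,k}(x,y)=e^{2\pi i(jx+ky)}$. $\mathfrak{T}_2$ is the algebra of trigonometric polynomials on $T^2$; for $t\in\mathfrak{T}_2$, $\mathrm{freq}(t)$ is the set of $(j,k)$ whose Fourier coefficient is nonzero. For $F\subseteq\mathbb{Z}^2$: $\mathfrak{T}_2(F)=\{t\in\mathfrak{T}_2:\mathrm{freq}(t)\subseteq F\}$; $\mathfrak{T}_2^{p}(F)=\{t\in\mathfrak{T}_2(F): t>0 \text{ everywhere on } T^2\}$; $\mathfrak{S}_2(F)=\{|t|^2:t\in\mathfrak{T}_2(F)\}$; $\mathfrak{U}_2(F)=\mathfrak{T}_2\cap\mathrm{cl}(\mathfrak{S}_2(F))$, closure in $C(T^2)$ with the supremum norm; $F-F=\{a-b:a,b\in F\}$. $F$ has Property A if $\mathfrak{T}_2^{p}(F-F)=\mathfrak{U}_2(F)$.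
   Formalization: Positivity in T_2^p(F-F) is taken as t ≥ 0 everywhere instead of t > 0; with strict positivity the equality fails for every F, since 0 = |0|^2 lies in U_2(F). *)

(* Defs.v *)
From mathcomp Require Import all_boot all_order all_algebra.
From mathcomp Require Import complex.
From mathcomp Require Import all_classical all_reals all_analysis.

Set Implicit Arguments.
Unset Strict Implicit.
Unset Printing Implicit Defensive.

Import Order.TTheory GRing.Theory Num.Theory.
Import numFieldNormedType.Exports.

Local Open Scope classical_set_scope.
Local Open Scope complex_scope.
Local Open Scope ring_scope.

(* A function on the torus T^2 = (R/Z)^2 is a function on R^2 that is
   1-periodic in each variable.  The alias R[i]^o carries the topology of the
   complex modulus. *)
Definition periodic2 (R : realType) (f : R * R -> R[i]^o) : Prop :=
  forall (x y : R) (j k : int), f (x + j%:~R, y + k%:~R) = f (x, y).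

(* C(T^2) *)
Definition CT2 (R : realType) : set (R * R -> R[i]^o) :=
  [set f | periodic2 f /\ continuous f].

(* e^{2 pi i (j x + k y)} *)
Definition echar (R : realType) (m : int * int) (z : R * R) : R[i]^o :=
  let theta := 2 * pi * (m.1%:~R * z.1 + m.2%:~R * z.2) in
  cos theta +i* sin theta.

(* The linear span of the characters. *)
Definition trigpoly (R : realType) : set (R * R -> R[i]^o) :=
  [set t | exists (s : seq (int * int)) (c : int * int -> R[i]),
     t = fun z => \sum_(m <- s) c m * echar m z].

(* The integral over T^2 with respect to normalized Haar measure, as an iterated
   integral over the fundamental domain [0, 1]^2; this is used for continuous
   functions only. *)
Definition intT2 (R : realType) (f : R * R -> R[i]) : R[i] :=
  let integral2 (g : R * R -> R) : R :=
    \int[lebesgue_measure]_(x in `[0, 1])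
      (\int[lebesgue_measure]_(y in `[0, 1]) g (x, y)) in
  integral2 (fun z => complex.Re (f z)) +i* integral2 (fun z => complex.Im (f z)).

Definition fourier (R : realType) (f : R * R -> R[i]) (m : int * int) : R[i] :=
  intT2 (fun z => f z * (echar m z)^*).

Definition freq (R : realType) (t : R * R -> R[i]^o) : set (int * int) :=
  [set m | fourier t m != 0].

(* The trigonometric polynomials with frequencies in F. *)
Definition T2 (R : realType) (F : set (int * int)) : set (R * R -> R[i]^o) :=
  [set t | trigpoly t /\ freq t `<=` F].

(* The order on R[i] is partial: 0 <= w says that w is real and nonnegative.
   Positivity is the nonstrict one: with 0 < t z the identity defining
   propertyA would fail for every F, because the zero polynomial lies in
   U2 F. *)
Definition T2p (R : realType) (F : set (int * int)) : set (R * R -> R[i]^o) :=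
  [set t | T2 F t /\ forall z, 0 <= t z].

Definition S2 (R : realType) (F : set (int * int)) : set (R * R -> R[i]^o) :=
  [set (fun z => `|s z| ^+ 2) | s in @T2 R F].

(* The topology of uniform convergence on C(T^2) is the one of the supremum
   norm. *)
Definition clCT2 (R : realType) (S : set (R * R -> R[i]^o)) :
    set (R * R -> R[i]^o) :=
  @CT2 R `&` closure (S : set {uniform (R * R)%type -> R[i]^o}).

Definition U2 (R : realType) (F : set (int * int)) : set (R * R -> R[i]^o) :=
  @trigpoly R `&` clCT2 (@S2 R F).

Definition diffset (F : set (int * int)) : set (int * int) :=
  [set a - b | a in F & b in F].

Definition propertyA (R : realType) (F : set (int * int)) : Prop :=
  @T2p R (diffset F) = @U2 R F.

Definition strip (R : realType) (alpha : rat) (beta : R) : set (int * int) :=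
  [set m | `|m.2%:~R - m.1%:~R * ratr alpha| < beta].

(* Main.v *)
(* Write alpha = p/q and u(j,k) = qk - pj, so that F = {|u| <= N} and F - F is
   contained in {|u| <= 2N}.  Let t >= 0 be a trigonometric polynomial
   with frequencies in {|u| <= n}, n = 2N; adding a small constant, assume t > 0.
   Approximate log t by a real trigonometric polynomial and write the latter as
   2 Re p with p supported in {u >= 0}.  For large K the trigonometric
   polynomials f = (1 + p/K)^K and g = (1 - p/K)^K, supported
   in {u >= 0}, satisfy |f|^2 ~ t and f g ~ 1 uniformly, hence f ~ t conj(g).
   As t conj(g) is supported in {u <= n}, the part of f in {u > n} has small L^2
   norm along every orbit of the direction v dual to u, so the truncation s of f
   to {0 <= u <= n} satisfies |s|^2 ~ t in L^1 along these orbits; both sides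
   being supported in {|u| <= n}, this improves to uniform closeness.  A shift
   of s by a frequency with u = -N puts it in F.

   Integrals along orbits are replaced by averages over M equally spaced nodes,
   which are exact on trigonometric polynomials as soon as M is large. *)
Require Import Defs.
From mathcomp Require Import all_boot all_order all_algebra.
From mathcomp Require Import complex.
From mathcomp Require Import all_classical all_reals all_analysis.
From mathcomp Require Import ring lra zify.

Set Implicit Arguments.
Unset Strict Implicit.
Unset Printing Implicit Defensive.

Import Order.TTheory GRing.Theory Num.Theory.
Import numFieldNormedType.Exports.
Import ComplexField.Normc.

Local Open Scope classical_set_scope.
Local Open Scope complex_scope.
Local Open Scope ring_scope.

(** * The unit circle and the characters of the torus *)

Section Characters.
Variable R : realType.
Implicit Types (m : int * int) (z : R * R) (v : int * int).

Definition cis (t : R) : R[i] := cos t +i* sin t.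

Lemma cis0 : cis 0 = 1.
Proof. by rewrite /cis cos0 sin0. Qed.

Lemma cisD s t : cis (s + t) = cis s * cis t.
Proof. by rewrite /cis cosD sinD; simpc; congr (_ +i* _); ring. Qed.

Lemma cisN t : cis (- t) = (cis t)^*.
Proof. by rewrite /cis cosN sinN. Qed.

Lemma cis_unit t : cis t * (cis t)^* = 1.
Proof. by rewrite -cisN -cisD subrr cis0. Qed.

Lemma normc_cis t : normc (cis t) = 1.
Proof. by rewrite /cis /= cos2Dsin2 sqrtr1. Qed.

Lemma cisMn t n : cis (t *+ n) = cis t ^+ n.
Proof. by elim: n => [|n IH]; rewrite ?cis0 // mulrS cisD IH exprS. Qed.

Lemma cis_int (k : int) : cis (2 * pi * k%:~R) = 1.
Proof.
have cn (n : nat) : cis (2 * pi * n%:R) = 1.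
  rewrite mulr_natr cisMn mulrC mulr_natr.
  have -> : cis (pi *+ 2) = 1 by rewrite /cis cos2pi sin2pi.
  by rewrite expr1n.
case: k => n; first exact: cn.
by rewrite NegzE mulrNz mulrN cisN cn rmorph1.
Qed.

(** By conjugation t > 0 may be assumed; then cos(2 pi t) = 1 - 2 sin(pi t)^2, and the sine is
    positive on ]0, pi[. *)
Lemma cis_neq1 (t : R) : 0 < `|t| < 1 -> cis (2 * pi * t) != 1.
Proof.
wlog t0 : t / 0 < t => [H|].
  case: (ltgtP t 0) => [tn|tp|->]; last by rewrite normr0 ltxx.
  - rewrite -normrN => /H; rewrite oppr_gt0 => /(_ tn).
    rewrite mulrN cisN; apply: contra => /eqP ->; by rewrite rmorph1.
  - exact: H.
rewrite gtr0_norm // => /andP[_ t1].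
apply/eqP => /(congr1 (@complex.Re R)) /= e.
have : 0 < sin (pi * t).
  apply: sin_gt0_pi; rewrite mulr_gt0 ?pi_gt0 //=.
  by rewrite -[ltRHS]mulr1 ltr_pM2l ?pi_gt0.
have : cos (2 * pi * t) = 1 - sin (pi * t) ^+ 2 *+ 2.
  by rewrite -mulrA mulr_natl cos_mulr2n cos2sin2; ring.
rewrite e; nra.
Qed.

(** A geometric sum whose ratio is an M-th root of unity; the bound on [k] makes the ratio differ
    from 1 unless k = 0, so no aliasing occurs. *)
Lemma sum_cis M (k : int) : (0 < M)%N -> (`|k| < M)%N ->
  \sum_(j < M) cis (2 * pi * (k%:~R * (j%:R / M%:R))) =
  if k == 0 then M%:R else 0.
Proof.
move=> M0 kM.
have MR : (M%:R : R) != 0 by rewrite pnatr_eq0 -lt0n.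
case: eqP => [->|/eqP k0].
  under eq_bigr => j _ do rewrite mul0r mulr0 cis0.
  by rewrite sumr_const card_ord.
set w := cis (2 * pi * (k%:~R / M%:R)).
have -> : \sum_(j < M) cis (2 * pi * (k%:~R * (j%:R / M%:R))) = \sum_(j < M) w ^+ j.
  apply: eq_bigr => j _; rewrite -cisMn; congr cis.
  by rewrite -mulr_natr; field.
have wM : w ^+ M = 1.
  rewrite -cisMn -[RHS](cis_int k); congr cis; rewrite -mulr_natr; by field.
have w1 : w != 1.
  apply: cis_neq1; rewrite normrM normfV (ger0_norm (ler0n _ _)).
  rewrite divr_gt0 ?ltr0n // ?normr_gt0 ?intr_eq0 //=.
  rewrite ltr_pdivrMr ?ltr0n // mul1r -intr_norm //.
  by rewrite -abszE -pmulrn ltr_nat.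
have : (w - 1) * \sum_(j < M) w ^+ j = 0 by rewrite -subrX1 wM subrr.
by move/eqP; rewrite mulf_eq0 subr_eq0 (negPf w1) => /eqP.
Qed.

(** For v = (-p, q) this is the form u(j,k) = qk - pj. By [echar_slide] it is the frequency of the
    character [m] along orbits of direction [v]. *)
Definition dot v m : int := v.1 * m.1 + v.2 * m.2.

Lemma dotD v m m' : dot v (m + m') = dot v m + dot v m'.
Proof. by rewrite /dot /=; ring. Qed.
Lemma dotN v m : dot v (- m) = - dot v m.
Proof. by rewrite /dot /=; ring. Qed.
Lemma dotB v m m' : dot v (m - m') = dot v m - dot v m'.
Proof. by rewrite dotD dotN. Qed.
Lemma dot0 v : dot v 0 = 0.
Proof. by rewrite /dot /= !mulr0. Qed.

Definition slide v z (t : R) : R * R := (z.1 + v.1%:~R * t, z.2 + v.2%:~R * t).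

Lemma echarE m z : echar m z = cis (2 * pi * (m.1%:~R * z.1 + m.2%:~R * z.2)).
Proof. by []. Qed.

Lemma echar0 z : echar 0 z = 1 :> R[i].
Proof. by rewrite echarE /= !mul0r addr0 mulr0 cis0. Qed.

Lemma echarD m m' z : echar (m + m') z = echar m z * echar m' z :> R[i].
Proof. by rewrite !echarE -cisD /= !intrD; congr cis; ring. Qed.

Lemma echarN m z : echar (- m) z = (echar m z)^* :> R[i].
Proof. by rewrite !echarE -cisN /= !mulrNz; congr cis; ring. Qed.

Lemma normc_echar m z : normc (echar m z) = 1.
Proof. exact: normc_cis. Qed.

Lemma echar_slide v m z t :
  echar m (slide v z t) = echar m z * cis (2 * pi * ((dot v m)%:~R * t)) :> R[i].
Proof.
rewrite !echarE -cisD /=; congr cis; rewrite /dot intrD !intrM; ring.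
Qed.

End Characters.

(** * Trigonometric polynomials *)

Section TrigPolys.
Variable R : realType.
Implicit Types (m : int * int) (z : R * R) (v : int * int).
Implicit Types (A B : set (int * int)) (f g : R * R -> R[i]).

(** An inductive form of the span, so that facts about frequencies are proved by induction without
    integrals. Frequencies may repeat and coefficients may vanish; [T2P] identifies it with [T2]. *)
Inductive tspan A : (R * R -> R[i]) -> Prop :=
| tspan0 : tspan A (fun=> 0)
| tspanS c m f : A m -> tspan A f -> tspan A (fun z => c * echar m z + f z).

Lemma eq_tspan A f g : f =1 g -> tspan A f -> tspan A g.
Proof. by move=> /funext ->. Qed.

Lemma sub_tspan A B f : A `<=` B -> tspan A f -> tspan B f.
Proof.
by move=> AB; elim=> [|c m g Am _ IH]; [exact: tspan0|apply: tspanS => //; exact: AB].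
Qed.

Lemma tspan_echar A c m : A m -> tspan A (fun z => c * echar m z).
Proof.
move=> Am; apply: eq_tspan (tspanS c Am (tspan0 A)) => z; by rewrite addr0.
Qed.

Lemma tspan_cst A c : A 0 -> tspan A (fun=> c).
Proof.
by move=> A0; apply: eq_tspan (tspan_echar c A0) => z; rewrite echar0 mulr1.
Qed.

Lemma tspanD A f g : tspan A f -> tspan A g -> tspan A (fun z => f z + g z).
Proof.
move=> sf sg; elim: sf => [|c m h Am _ IH].
  by apply: eq_tspan sg => z; rewrite add0r.
by apply: eq_tspan (tspanS c Am IH) => z; rewrite addrA.
Qed.

Lemma tspanM_echar A B c m f : (forall a, A a -> B (m + a)) ->
  tspan A f -> tspan B (fun z => c * echar m z * f z).
Proof.
move=> AB; elim=> [|d a h Aa _ IH].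
  by apply: eq_tspan (tspan0 B) => z; rewrite mulr0.
apply: eq_tspan (tspanS (c * d) (AB _ Aa) IH) => z; rewrite echarD; ring.
Qed.

Lemma tspanM A B D f g : (forall a b, A a -> B b -> D (a + b)) ->
  tspan A f -> tspan B g -> tspan D (fun z => f z * g z).
Proof.
move=> ABD sf sg; elim: sf => [|c m h Am _ IH].
  by apply: eq_tspan (tspan0 D) => z; rewrite mul0r.
have := tspanD (tspanM_echar c (fun b => ABD m b Am) sg) IH.
by apply: eq_tspan => z; rewrite mulrDl.
Qed.

Lemma tspanZ A c f : tspan A f -> tspan A (fun z => c * f z).
Proof.
move=> sf; have A0 a : A a -> A (0 + a) by rewrite add0r.
by apply: eq_tspan (tspanM_echar c A0 sf) => z; rewrite echar0 mulr1.
Qed.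

Lemma tspanB A f g : tspan A f -> tspan A g -> tspan A (fun z => f z - g z).
Proof.
move=> sf sg; apply: eq_tspan (tspanD sf (tspanZ (-1) sg)) => z; by rewrite mulN1r.
Qed.

Lemma tspan_conj A B f : (forall a, A a -> B (- a)) ->
  tspan A f -> tspan B (fun z => (f z)^*).
Proof.
move=> AB; elim=> [|c m h Am _ IH].
  by apply: eq_tspan (tspan0 B) => z; rewrite rmorph0.
apply: eq_tspan (tspanS (c^*) (AB _ Am) IH) => z.
by rewrite echarN rmorphD rmorphM.
Qed.

Lemma tspanX A f n : A 0 -> (forall a b, A a -> A b -> A (a + b)) ->
  tspan A f -> tspan A (fun z => f z ^+ n).
Proof.
move=> A0 AD sf; elim: n => [|n IH].
  by apply: eq_tspan (tspan_cst 1 A0) => z; rewrite expr0.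
by apply: eq_tspan (tspanM AD sf IH) => z; rewrite exprS.
Qed.

Lemma tspan_sum A (I : eqType) (s : seq I) (F : I -> R * R -> R[i]) :
  (forall i, i \in s -> tspan A (F i)) -> tspan A (fun z => \sum_(i <- s) F i z).
Proof.
elim: s => [|i s IH] sF.
  by apply: eq_tspan (tspan0 A) => z; rewrite big_nil.
have sF' j : j \in s -> tspan A (F j) by move=> js; apply: sF; rewrite inE js orbT.
apply: eq_tspan (tspanD (sF i (mem_head _ _)) (IH sF')) => z.
by rewrite big_cons.
Qed.

Lemma tspan_split A B f : tspan A f ->
  exists f1 f2,
    [/\ tspan (A `&` B) f1, tspan (A `\` B) f2 & f =1 fun z => f1 z + f2 z].
Proof.
elim=> [|c m h Am _ [f1 [f2 [s1 s2 e]]]].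
  exists (fun=> 0), (fun=> 0); split; try exact: tspan0.
  by move=> z; rewrite addr0.
have [Bm|nBm] := pselect (B m).
- exists (fun z => c * echar m z + f1 z), f2; split => //; first exact: tspanS.
  by move=> z; rewrite e addrA.
- exists f1, (fun z => c * echar m z + f2 z); split => //; first exact: tspanS.
  by move=> z; rewrite e addrCA.
Qed.

Lemma normc_ge0 (w : R[i]) : 0 <= normc w.
Proof. by case: w => a b; exact: sqrtr_ge0. Qed.

Lemma tspan_bounded A f : tspan A f -> exists2 C : R, 0 < C & forall z, normc (f z) <= C.
Proof.
elim=> [|c m h Am _ [C C0 hC]].
  by exists 1 => // z; rewrite normc0.
exists (normc c + C) => [|z]; first by rewrite ltr_wpDl ?normc_ge0.
apply: le_trans (le_normcD _ _) _.
by rewrite normcM normc_echar mulr1 lerD2l.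
Qed.

(** Only finitely many frequencies occur; the bound [W] tells how many nodes make the averages
    exact. *)
Lemma tspan_dot_bounded A v f : tspan A f ->
  exists W : nat, tspan (A `&` [set m | (`|dot v m| <= W)%N]) f.
Proof.
elim=> [|c m h Am _ [W hW]]; first by exists 0%N; exact: tspan0.
exists (maxn W `|dot v m|); apply: tspanS; first by split=> //=; rewrite leq_maxr.
by apply: sub_tspan hW => a [Aa /= aW]; split=> //=; rewrite leq_max aW.
Qed.

Lemma tspan_uniq A f : tspan A f -> exists s (c : int * int -> R[i]),
  uniq s /\ f = fun z => \sum_(m <- s) c m * echar m z.
Proof.
elim=> [|c m h _ _ [s [d [us ->]]]].
  by exists [::], (fun=> 0); split => //; apply: funext => z; rewrite big_nil.
(* Outside [s] the values of [d] are arbitrary, so they are cut to 0 before the new coefficient is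
   added at [m]. *)
pose d' a := (if a == m then c else 0) + (if a \in s then d a else 0).
have es z : \sum_(a <- s) (if a \in s then d a else 0) * (echar a z : R[i]) =
    \sum_(a <- s) d a * (echar a z : R[i]).
  by rewrite big_seq [RHS]big_seq; apply: eq_bigr => a ->.
have [ms|ms] := boolP (m \in s).
- exists s, d'; split => //; apply: funext => z.
  under [RHS]eq_bigr do rewrite mulrDl.
  rewrite big_split /= es; congr (_ + _).
  rewrite (bigD1_seq m) //= eqxx big1 ?addr0 // => a /negPf ->; by rewrite mul0r.
- exists (m :: s), d'; split; first by rewrite /= ms.
  apply: funext => z; rewrite big_cons /d' eqxx (negPf ms) addr0; congr (_ + _).
  rewrite -es [in LHS]big_seq [in RHS]big_seq; apply: eq_bigr => a as_.
  rewrite (_ : (a == m) = false) ?add0r //.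
  by apply/negP => /eqP e; rewrite -e as_ in ms.
Qed.

Lemma trigpolyP f : trigpoly f <-> tspan setT f.
Proof.
split=> [[s [c ->]]|/tspan_uniq[s [c [_ ->]]]]; last by exists s, c.
by apply: tspan_sum => m _; exact: tspan_echar.
Qed.

End TrigPolys.

(** * Averages over equally spaced nodes *)

Section Sampling.
Variable R : realType.
Implicit Types (m : int * int) (z : R * R) (v : int * int).
Implicit Types (A B : set (int * int)) (f g h : R * R -> R[i]).

Lemma normc_sqr (w : R[i]) : ((normc w) ^+ 2)%:C = w * w^*.
Proof. by rewrite -normCK rmorphXn. Qed.

Lemma normc_conj (w : R[i]) : normc w^* = normc w.
Proof. by case: w => a b /=; rewrite sqrrN. Qed.

Lemma normc_natl (n : nat) : normc (n%:R : R[i]) = n%:R.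
Proof. by rewrite normcMn normc1. Qed.

Lemma le_normc_sum (I : Type) (s : seq I) (F : I -> R[i]) :
  normc (\sum_(i <- s) F i) <= \sum_(i <- s) normc (F i).
Proof.
elim: s => [|i s IH]; first by rewrite !big_nil normc0.
by rewrite !big_cons; apply: le_trans (le_normcD _ _) _; rewrite lerD2l.
Qed.

Definition node v M z (j : nat) : R * R := slide v z (j%:R / M%:R).

Lemma sum_node v M z h : (0 < M)%N ->
  tspan [set m | dot v m != 0 /\ (`|dot v m| < M)%N] h ->
  \sum_(j < M) h (node v M z j) = 0.
Proof.
move=> M0; elim=> [|c m f [/= m0 mM] _ IH]; first by rewrite big1.
rewrite big_split /= IH addr0 -mulr_sumr.
under eq_bigr do rewrite echar_slide.
by rewrite -mulr_sumr sum_cis // (negPf m0) !mulr0.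
Qed.

(** The Dirichlet kernel of degree [n] at the node j/M; n - i runs from n down to -n. *)
Definition dirichlet (n M j : nat) : R[i] :=
  \sum_(i < n.*2.+1) cis (2 * pi * ((n%:Z - i%:Z)%:~R * (j%:R / M%:R))).

Lemma normc_dirichlet n M j : normc (dirichlet n M j) <= n.*2.+1%:R.
Proof.
apply: le_trans (le_normc_sum _ _) _.
under eq_bigr do rewrite normc_cis.
by rewrite sumr_const card_ord.
Qed.

(** The reproducing property of the Dirichlet kernel on polynomials of degree at most [n] along the
    orbit. The products have frequencies of size at most 2n < M, so only the zero frequency
    survives. *)
Lemma sum_dirichlet v n M z h : (n.*2 < M)%N ->
  tspan [set m | (`|dot v m| <= n)%N] h ->
  \sum_(j < M) h (node v M z j) * dirichlet n M j = M%:R * h z.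
Proof.
move=> nM; elim=> [|c m f /= mn _ IH].
  by rewrite mulr0 big1 // => j _; rewrite mul0r.
under eq_bigr do rewrite mulrDl.
rewrite big_split /= IH mulrDr; congr (_ + _).
under eq_bigr do rewrite echar_slide (mulrA c) -(mulrA (c * _)) /dirichlet mulr_sumr.
rewrite -mulr_sumr. rewrite exchange_big /=.
have M0 : (0 < M)%N by apply: leq_ltn_trans nM.
(* The one index of the kernel whose frequency n - k0 cancels [dot v m]. *)
pose k0 := `|(dot v m + n%:Z)%R|%N.
have k0E : k0%:Z = dot v m + n%:Z by rewrite /k0 gez0_abs; lia.
have k0n : (k0 < n.*2.+1)%N by lia.
have E (i : 'I_n.*2.+1) : \sum_(j < M) cis (2 * pi * ((dot v m)%:~R * (j%:R / M%:R))) *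
     cis (2 * pi * ((n%:Z - i%:Z)%:~R * (j%:R / M%:R))) =
   if i == Ordinal k0n then M%:R else 0 :> R[i].
  under eq_bigr do rewrite -cisD -mulrDr -mulrDl -intrD.
  have -> : (i == Ordinal k0n) = (dot v m + (n%:Z - i%:Z) == 0).
    by rewrite -val_eqE /=; lia.
  by rewrite sum_cis //; have := ltn_ord i; lia.
rewrite (eq_bigr _ (fun i _ => E i)) -big_mkcond big_pred1_eq; ring.

Qed.

(** Turns smallness in mean along orbits into uniform smallness, at the cost of the bound 2n + 1 on
    the kernel. *)
Lemma normc_le_mean v n M z h : (n.*2 < M)%N ->
  tspan [set m | (`|dot v m| <= n)%N] h ->
  M%:R * normc (h z) <= n.*2.+1%:R * \sum_(j < M) normc (h (node v M z j)).
Proof.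
move=> nM sh; rewrite -(normc_natl M) -[leLHS]normcM -(sum_dirichlet z nM sh).
apply: le_trans (le_normc_sum _ _) _; rewrite mulr_sumr; apply: ler_sum => j _.
by rewrite normcM mulrC ler_wpM2r ?normc_ge0 ?normc_dirichlet.
Qed.

(** Pythagoras: f conj(g) has no zero frequency along [v] and none large enough to alias, so [f] and
    [g] are orthogonal for the sum over the nodes. *)
Lemma bessel v M z A B f g : (0 < M)%N -> tspan A f -> tspan B g ->
  (forall a b, A a -> B b -> dot v (a - b) != 0 /\ (`|dot v (a - b)%R| < M)%N) ->
  \sum_(j < M) normc (f (node v M z j)) ^+ 2 <=
  \sum_(j < M) normc (f (node v M z j) + g (node v M z j)) ^+ 2.
Proof.
move=> M0 sf sg AB.
have orth : \sum_(j < M) f (node v M z j) * (g (node v M z j))^* = 0.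
  apply: (@sum_node v M z (fun z => f z * (g z)^*)) => //.
  apply: tspanM sf (tspan_conj (B := [set - b | b in B]) _ sg).
    by move=> a _ Aa [b Bb <-]; exact: AB.
  by move=> b Bb; exists b.
rewrite -lecR !rmorph_sum /=.
under [leRHS]eq_bigr => j _.
  rewrite normc_sqr rmorphD mulrDl !mulrDr.
  rewrite -[f _ * (f _)^*]normc_sqr -[g _ * (g _)^*]normc_sqr addrA.
  over.
rewrite !big_split /= orth addr0 -addrA lerDl.
have -> : \sum_(i < M) g (node v M z i) * (f (node v M z i))^* = 0.
  rewrite -[RHS]conjC0 -[in RHS]orth rmorph_sum; apply: eq_bigr => j _ /=.
  by rewrite rmorphM /= conjCK mulrC.
by rewrite add0r sumr_ge0 // => j _; rewrite lecR sqr_ge0.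
Qed.

Lemma sqr_normc_dist (a b : R[i]) (C : R) : normc a <= C ->
  normc (a * a^* - (a - b) * (a - b)^*) <= 2 * C * normc b + normc b ^+ 2.
Proof.
move=> aC.
have -> : a * a^* - (a - b) * (a - b)^* = a * b^* + b * a^* - b * b^*.
  by rewrite rmorphB; ring.
have H := le_normcD (a * b^* + b * a^*) (- (b * b^*)).
have H' := le_normcD (a * b^*) (b * a^*).
rewrite normcN !normcM !normc_conj in H H'.
have := normc_ge0 b; nra.
Qed.

(* The hypothesis on f - t conj(g) says that f is nearly supported in {u <= n};
   the factor 2n + 1 bounds the Dirichlet kernel. *)
Lemma truncation v (n : nat) t f g (C eta eta' : R) :
  tspan [set m | (`|dot v m| <= n)%N] t ->
  tspan [set m | 0 <= dot v m] f -> tspan [set m | 0 <= dot v m] g ->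
  0 < eta ->
  (forall z, normc (f z) <= C) ->
  (forall z, normc (f z - t z * (g z)^*) <= eta) ->
  (forall z, normc (t z - f z * (f z)^*) <= eta') ->
  exists2 s, tspan [set m | 0 <= dot v m <= n%:Z] s &
    forall z, normc (t z - s z * (s z)^*) <=
      n.*2.+1%:R * (eta' + 2 * C * eta + eta ^+ 2).
Proof.
move=> st sf sg eta0 fC rE tE.
have C0 : 0 <= C by apply: le_trans (fC 0); exact: normc_ge0.
have [s [rho [ss srho fE]]] := tspan_split [set m | dot v m <= n%:Z] sf.
exists s; first by apply: sub_tspan ss => m [/= -> ->].
move=> z.
(* As f = s + rho, the function f - t conj(g) is the sum of [rho], supported in {u > n}, and of this
   one, supported in {u <= n}. *)
have sb : tspan [set m | dot v m <= n%:Z] (fun z => s z - t z * (g z)^*).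
  apply: tspanB; first by apply: sub_tspan ss => m [].
  apply: tspanM st (tspan_conj (B := [set m | dot v m <= 0]) _ sg) => [a b|a] /=.
    by rewrite dotD; lia.
  by rewrite dotN; lia.
have [W1 srho'] := tspan_dot_bounded v srho.
have [W2 sb'] := tspan_dot_bounded v sb.
(* More than W1 + W2 nodes for [bessel], more than 2n for [normc_le_mean]. *)
pose M := (W1 + W2 + n.*2).+1.
have nM : (n.*2 < M)%N by rewrite /M; lia.
have M0 : (0 < M)%N by [].
have ME : \sum_(j < M) (1 : R) = M%:R by rewrite sumr_const card_ord.
have B1 : \sum_(j < M) normc (rho (node v M z j)) ^+ 2 <= M%:R * eta ^+ 2.
  have := @bessel v M z _ _ _ _ M0 srho' sb'.
  have AB : forall a b, (([set m | 0 <= dot v m] `\` [set m | dot v m <= n%:Z])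
      `&` [set m | (`|dot v m| <= W1)%N]) a ->
     ([set m | dot v m <= n%:Z] `&` [set m | (`|dot v m| <= W2)%N]) b ->
     dot v (a - b) != 0 /\ (`|dot v (a - b)%R| < M)%N.
    by move=> a b [[/= a0 an] aW] [/= bn bW]; rewrite dotB /M; split; lia.
  move=> /(_ AB) /le_trans; apply.
  rewrite -ME mulr_suml; apply: ler_sum => j _; rewrite mul1r.
  rewrite ler_sqr ?nnegrE ?normc_ge0 ?(ltW eta0) //.
  by rewrite addrA [rho _ + _]addrC -fE; exact: rE.
have sD : tspan [set m | (`|dot v m| <= n)%N] (fun z => t z - s z * (s z)^*).
  apply: tspanB => //.
  apply: tspanM ss (tspan_conj (B := [set m | - n%:Z <= dot v m <= 0]) _ ss) => [a b|a] /=.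
    by move=> [/= ? ?] ?; rewrite dotD; lia.
  by move=> [/= ? ?]; rewrite dotN; lia.
have := normc_le_mean z nM sD.
set S := \sum_(j < M) _ => DS.
have SE : S <= M%:R * (eta' + 2 * C * eta + eta ^+ 2).
  have P j : normc (t (node v M z j) - s (node v M z j) * (s (node v M z j))^*) <=
      (eta' + C * eta) + (C / eta + 1) * normc (rho (node v M z j)) ^+ 2.
    set w := node v M z j.
    have -> : t w - s w * (s w)^* =
        (t w - f w * (f w)^*) + (f w * (f w)^* - (f w - rho w) * (f w - rho w)^*).
      by rewrite (fE w) addrK; ring.
    apply: le_trans (le_normcD _ _) _.
    have H1 := sqr_normc_dist (rho w) (fC w).
    have H2 := tE w.
    (* AM-GM: only the mean square of rho is known to be small. *)
    have H3 : 2 * normc (rho w) <= eta + normc (rho w) ^+ 2 / eta.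
      rewrite -(ler_pM2r eta0) [leRHS]mulrDl mulfVK ?gt_eqF //.
      have := sqr_ge0 (normc (rho w) - eta); nra.
    have H4 := ler_wpM2l C0 H3.
    have -> : (C / eta + 1) * normc (rho w) ^+ 2 =
      C * (normc (rho w) ^+ 2 / eta) + normc (rho w) ^+ 2 by ring.
    by nra.
  apply: le_trans (ler_sum _ (fun (j : 'I_M) _ => P j)) _.
  rewrite big_split /= -mulr_sumr sumr_const card_ord -mulr_natl.
  have Ce : 0 <= C / eta + 1 by rewrite addr_ge0 ?divr_ge0 // ltW.
  have H := ler_wpM2l Ce B1.
  (* The factor 1 / eta from the AM-GM step is absorbed by the mean square bound eta^2 on [rho]. *)
  have E : (C / eta + 1) * (M%:R * eta ^+ 2) = M%:R * (C * eta + eta ^+ 2).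
    by field; rewrite gt_eqF.
  rewrite E in H; lra.
rewrite -(ler_pM2l (x := M%:R)) ?ltr0n // mulrCA.
by apply: le_trans DS _; rewrite ler_wpM2l ?ler0n.
Qed.

End Sampling.

(** * Elementary estimates for exp and ln *)

Section Logarithm.
Variable R : realType.
Implicit Types (d e x y w B D : R).

Lemma expR_sub1_le y : 0 <= y <= 1 / 2 -> expR y - 1 <= 2 * y.
Proof.
move=> /andP[y0 y1].
have E0 := expR_gt0 y; have E1 := expR_ge1Dx (- y).
have : expR y * (1 - y) <= 1.
  by rewrite -[leRHS](expRxMexpNx_1 y) ler_wpM2l //; exact: ltW.
nra.
Qed.

Lemma expR_sub1_norm y : `|y| <= 1 / 2 -> `|expR y - 1| <= 2 * `|y|.
Proof.
move=> y1; have E1 := expR_ge1Dx y.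
case: (lerP 0 y) => y0.
  rewrite ger0_norm // in y1.
  have E2 : expR y - 1 <= 2 * y by apply: expR_sub1_le; rewrite y0.
  by rewrite [`|y|]ger0_norm // ger0_norm //; lra.
have : expR y < 1 by rewrite expR_lt1.
rewrite (ltr0_norm y0) => h; rewrite ltr0_norm; lra.
Qed.

Lemma expn_le_expR x n : 0 <= 1 + x -> (1 + x) ^+ n <= expR (n%:R * x).
Proof.
by move=> x0; rewrite expRM_natl lerXn2r ?nnegrE ?expR_ge0 // expR_ge1Dx.
Qed.

Lemma bernoulli y n : 0 <= y <= 1 -> 1 - n%:R * y <= (1 - y) ^+ n.
Proof.
move=> /andP[y0 y1]; elim: n => [|n IH]; first by rewrite expr0 mul0r subr0.
rewrite exprSr -natr1.
have n0 : 0 <= n%:R * y by rewrite mulr_ge0.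
have := ler_wpM2r (_ : 0 <= 1 - y) IH; rewrite subr_ge0 => /(_ y1).
nra.
Qed.

(** Multiplying exp(x) (1 - x) <= 1 by 1 + x gives exp(x) (1 - x^2) <= 1 + x; the n-th power is then
    bounded below by Bernoulli's inequality. *)
Lemma expn_ge_expR x n : 0 <= 1 + x -> x ^+ 2 <= 1 ->
  expR (n%:R * x) * (1 - n%:R * x ^+ 2) <= (1 + x) ^+ n.
Proof.
move=> x0 x1.
have H : expR x * (1 - x ^+ 2) <= 1 + x.
  have E0 := expR_ge1Dx (- x).
  have : (1 - x) * expR x <= 1.
    by rewrite -[leRHS](expRxMexpNx_1 x) mulrC ler_wpM2l // expR_ge0.
  nra.
apply: le_trans (_ : (expR x * (1 - x ^+ 2)) ^+ n <= _); last first.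
  rewrite lerXn2r ?nnegrE // mulr_ge0 ?expR_ge0 ?subr_ge0 //.
rewrite exprMn expRM_natl ler_wpM2l ?exprn_ge0 ?expR_ge0 // bernoulli //.
by rewrite sqr_ge0.
Qed.

(** A quantitative limit (1 + x/K)^K -> exp(l) in which [x] may exceed [l] by O(1/K). This slack
    absorbs the second-order term of |1 + p/K|^2. *)
Lemma exp_limit (B : R) (l x : R) (K : nat) : 1 <= B -> (0 < K)%N ->
  l <= x <= l + B / K%:R -> `|x| <= B -> 2 * B ^+ 2 <= K%:R ->
  `|(1 + x / K%:R) ^+ K - expR l| <= expR l * (2 * B ^+ 2 / K%:R).
Proof.
move=> B1 K0 /andP[lx xl] xB BK.
have KR : 0 < K%:R :> R by rewrite ltr0n.
have BB : B <= B ^+ 2 by nra.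
have KE : K%:R * (x / K%:R) = x by rewrite mulrC divfK ?gt_eqF.
have xK : - 1 <= x / K%:R <= 1.
  by rewrite ler_pdivlMr // ler_pdivrMr //; move: xB; rewrite ler_norml => /andP[]; nra.
have x1 : 0 <= 1 + x / K%:R by case/andP: xK; lra.
have U := expn_le_expR K x1.
have x2 : (x / K%:R) ^+ 2 <= 1 by case/andP: xK; nra.
have L := expn_ge_expR K x1 x2.
rewrite KE in U L.
have E0 := expR_gt0 l.
have BK2 : 0 <= B / K%:R <= 1 / 2.
  by rewrite divr_ge0 //=; [rewrite ler_pdivrMr //; nra|lra].
have Ux : expR x <= expR l * (1 + 2 * (B / K%:R)).
  apply: le_trans (_ : expR (l + B / K%:R) <= _); first by rewrite ler_expR.
  rewrite expRD ler_wpM2l ?expR_ge0 //.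
  by have := expR_sub1_le BK2; lra.
have Lx : expR l <= expR x by rewrite ler_expR.
have sq : K%:R * (x / K%:R) ^+ 2 <= B ^+ 2 / K%:R.
  have -> : K%:R * (x / K%:R) ^+ 2 = x ^+ 2 / K%:R by field; rewrite gt_eqF.
  rewrite ler_pM2r ?invr_gt0 //; rewrite -real_normK ?num_real //.
  by rewrite ler_sqr ?nnegrE //; lra.
have BK' : B / K%:R <= B ^+ 2 / K%:R by rewrite ler_pM2r ?invr_gt0.
have BK3 : B ^+ 2 / K%:R <= 1 / 2 by rewrite ler_pdivrMr //; lra.
rewrite -mulrA; set q := B ^+ 2 / K%:R in sq BK' BK3 *.
set r := K%:R * _ in sq L *.
have : expR l * (1 - q) <= expR x * (1 - r).
  by apply: ler_pM; rewrite ?expR_ge0 //; lra.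
rewrite ler_norml; move: Ux; set b := B / _ in BK' * => Ux Q.
have qb := ler_wpM2l (ltW E0) BK'.
apply/andP; split; nra.
Qed.

(** From (1 - d)^K <= exp(-Kd) <= 1 / (1 + Kd). *)
Lemma expr_small d e : 0 < d <= 1 -> 0 < e -> exists K : nat, (1 - d) ^+ K <= e.
Proof.
move=> /andP[d0 d1] e0; exists (Num.truncn (d * e)^-1).+1.
set K := _.+1.
have KE : (d * e)^-1 < K%:R by rewrite truncnS_gt // invr_ge0 mulr_ge0 ?ltW.
apply: le_trans (expn_le_expR _ _) _; first by lra.
rewrite mulrN expRN -[e]invrK lef_pV2 ?posrE ?expR_gt0 ?invr_gt0 //.
apply: le_trans (expR_ge1Dx _).
rewrite invfM mulrC ltr_pdivrMr // in KE; lra.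
Qed.

(** The remainder vanishes at 0 and has derivative -x^K / (1 - x), of size at most (1 - d)^K / d on
    [0, 1 - d]; the mean value theorem concludes. *)
Lemma ln_taylor d e : 0 < d <= 1 -> 0 < e -> exists K : nat,
  forall w, 0 <= w <= 1 - d ->
    `|ln (1 - w) + \sum_(k < K) w ^+ k.+1 / k.+1%:R| <= e.
Proof.
move=> d01 e0; have [d0 d1] := andP d01.
have [K HK] := expr_small d01 (mulr_gt0 d0 e0).
exists K => w /andP[w0 wd].
pose F : R -> R := (@ln R) \o (fun x => 1 - x) +
  \sum_(k < K) ((k.+1%:R^-1 : R) \*: ((@idfun R) ^+ k.+1)).
have FE x : F x = ln (1 - x) + \sum_(k < K) x ^+ k.+1 / k.+1%:R.
  rewrite /F fctE fct_sumE /=; congr (_ + _); apply: eq_bigr => k _.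
  by rewrite fctE mulrC.
pose dF x := - (1 - x)^-1 + \sum_(k < K) x ^+ k.
have HF x : 0 <= x <= 1 - d -> is_derive x 1 F (dF x).
  move=> /andP[x0 xd].
  have x1 : 0 < 1 - x by lra.
  have D1 := is_derive1_ln x1.
  have D2 : is_derive x 1 (fun x : R => 1 - x) (- 1).
    have := is_deriveB (is_derive_cst (1 : R) x 1) (is_derive_id x 1).
    by rewrite sub0r; exact.
  have D3 (k : 'I_K) : is_derive x 1 ((k.+1%:R^-1 : R) \*: ((@idfun R) ^+ k.+1) : R -> R) (x ^+ k).
    apply: is_derive_eq (is_deriveZ _ (is_deriveX k.+1 (is_derive_id x (1 : R)))) _.
    by rewrite /= /GRing.scale /= mulr1 mulKf // pnatr_eq0.
  have D4 := is_derive_sum D3.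
  have D5 : is_derive x 1 ((@ln R) \o (fun x => 1 - x)) ((1 - x)^-1 * -1).
    exact: is_derive1_comp.
  have := is_deriveD D5 D4; rewrite mulrN1; exact.
have dFE x : 0 <= x <= 1 - d -> dF x = - (x ^+ K / (1 - x)).
  move=> /andP[x0 xd].
  have x1 : 1 - x != 0 by apply/eqP; lra.
  apply: (mulIf x1); rewrite /dF mulrDl !mulNr mulVf // divfK //.
  rewrite mulrC -[1 - x]opprB mulNr -subrX1.
  by ring.
have F0 : F 0 = 0.
  rewrite FE subr0 ln1 add0r big1 // => k _; by rewrite expr0n mul0r.
have wI y : y \in `]0, w[ -> 0 <= y <= 1 - d.
  by rewrite in_itv /= => /andP[y0 yw]; rewrite ltW //=; lra.
have [|c cI] := @MVT_segment R F dF 0 w w0 (fun y yI => HF y (wI y yI)).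
  apply: derivable_within_continuous => y; rewrite in_itv /= => /andP[y0 yw].
  by apply: ex_derive; apply: HF; rewrite y0; lra.
rewrite F0 !subr0 FE => ->.
have cd : 0 <= c <= 1 - d.
  by move: cI; rewrite in_itv /= => /andP[-> cw]; lra.
rewrite dFE // normrM normrN.
have [c0 c1] := andP cd.
have cK : 0 <= c ^+ K <= d * e.
  rewrite exprn_ge0 //= (le_trans _ HK) // lerXn2r ?nnegrE //; lra.
have [cK0 cK1] := andP cK.
have cV : 0 <= c ^+ K / (1 - c) <= e.
  rewrite divr_ge0 //=; last lra.
  rewrite ler_pdivrMr; last lra.
  by rewrite (le_trans cK1) // mulrC ler_pM2l //; lra.
have [V0 V1] := andP cV.
rewrite (ger0_norm V0) (ger0_norm w0); nra.
Qed.

End Logarithm.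

(** * Approximate analytic factorization *)

Section Factor.
Variable R : realType.
Implicit Types (m : int * int) (z : R * R) (v : int * int).
Implicit Types (A B : set (int * int)) (f g h : R * R -> R[i]).

Lemma ReD (a b : R[i]) : complex.Re (a + b) = complex.Re a + complex.Re b.
Proof. by case: a => ? ?; case: b. Qed.

Lemma Re_conj (a : R[i]) : complex.Re a^* = complex.Re a.
Proof. by case: a. Qed.

Lemma Re_real_mul (c : R) (a : R[i]) : complex.Re (c%:C * a) = c * complex.Re a.
Proof. by case: a => ? ? /=; rewrite mul0r subr0. Qed.

Lemma normc_sqrE (a : R[i]) : normc a ^+ 2 = complex.Re a ^+ 2 + complex.Im a ^+ 2.
Proof. by case: a => x y /=; rewrite sqr_sqrtr // addr_ge0 ?sqr_ge0. Qed.

Lemma Re_le_normc (a : R[i]) : `|complex.Re a| <= normc a.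
Proof.
rewrite -ler_sqr ?nnegrE ?normc_ge0 // real_normK ?num_real // normc_sqrE.
by rewrite lerDl sqr_ge0.
Qed.

Lemma normc_real (c : R) : normc c%:C = `|c|.
Proof. by rewrite /= expr0n addr0 sqrtr_sqr. Qed.

Lemma normcX (a : R[i]) n : normc (a ^+ n) = normc a ^+ n.
Proof. by elim: n => [|n IH]; rewrite ?expr0 ?normc1 // !exprS normcM IH. Qed.

(** The expansion of (1 + a)^n - 1 in powers of [a] has nonnegative coefficients. *)
Lemma normc_exp1_sub1 (a : R[i]) n : normc ((1 + a) ^+ n - 1) <= (1 + normc a) ^+ n - 1.
Proof.
elim: n => [|n IH]; first by rewrite !expr0 !subrr normc0.
have -> : (1 + a) ^+ n.+1 - 1 = ((1 + a) ^+ n - 1) * (1 + a) + a by rewrite exprSr; ring.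
have -> : (1 + normc a) ^+ n.+1 - 1 = ((1 + normc a) ^+ n - 1) * (1 + normc a) + normc a.
  by rewrite exprSr; ring.
apply: le_trans (le_normcD _ _) _; rewrite lerD2r normcM.
apply: ler_pM; rewrite ?normc_ge0 //.
by apply: le_trans (le_normcD _ _) _; rewrite normc1.
Qed.

(* Fold the part of h in {u < 0} onto {u > 0} by conjugation and halve. *)
Lemma half_real_part v h : tspan setT h ->
  exists2 p, tspan [set m | 0 <= dot v m] p &
    forall z, 2 * complex.Re (p z) = complex.Re (h z).
Proof.
move=> sh; have [a [h' [sa sh' hE]]] := tspan_split [set m | 0 < dot v m] sh.
have [b [c [sb sc h'E]]] := tspan_split [set m | dot v m = 0] sh'.
exists (fun z => (2^-1)%:C * (a z + ((c z)^* + b z))).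
  apply: tspanZ; apply: tspanD.
    by apply: sub_tspan sa => m [_ /= /ltW].
  apply: tspanD; last by apply: sub_tspan sb => m [_ /= ->].
  by apply: tspan_conj sc => m [[_ /= m1] /= m2]; rewrite dotN; lia.
by move=> z; rewrite Re_real_mul hE h'E !ReD Re_conj; lra.
Qed.

Lemma exp_factor v p (T e : R) : tspan [set m | 0 <= dot v m] p ->
  (forall z, expR (2 * complex.Re (p z)) <= T) -> 0 < e ->
  exists f g, [/\ tspan [set m | 0 <= dot v m] f, tspan [set m | 0 <= dot v m] g &
    forall z, `|normc (f z) ^+ 2 - expR (2 * complex.Re (p z))| <= e /\
      normc (f z * g z - 1) <= e].
Proof.
move=> sp pT e0; have [b b0 pb] := tspan_bounded sp.
have T0 : 0 < T by apply: lt_le_trans (pT 0); exact: expR_gt0.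
(* Bounds |2 Re p + |p|^2 / K|; the summand 1 ensures B >= 1. *)
pose B := 1 + 2 * b + b ^+ 2.
have B1 : 1 <= B by rewrite /B; nra.
have B0 : 0 <= B by lra.
(* Large enough for both 2 B^2 <= K and (T + 1) 2 B^2 / K <= e. *)
pose K := (Num.truncn (2 * B ^+ 2 * (1 + (T + 1) / e))).+1.
have Te : 0 < (T + 1) / e by rewrite divr_gt0 //; lra.
have KE : 2 * B ^+ 2 * (1 + (T + 1) / e) < K%:R.
  by rewrite truncnS_gt // mulr_ge0 ?mulr_ge0 ?sqr_ge0 //; lra.
have K0 : (0 < K)%N by [].
have KR : 0 < K%:R :> R by rewrite ltr0n.
have BB : B <= B ^+ 2 by nra.
have K1 : 2 * B ^+ 2 <= K%:R by nra.
have K2 : (T + 1) * (2 * B ^+ 2 / K%:R) <= e.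
  rewrite mulrA ler_pdivrMr //.
  have : e * (2 * B ^+ 2 * (1 + (T + 1) / e)) <= e * K%:R by rewrite ler_pM2l // ltW.
  have -> : e * (2 * B ^+ 2 * (1 + (T + 1) / e)) = 2 * B ^+ 2 * e + (T + 1) * (2 * B ^+ 2).
    by field; rewrite gt_eqF.
  by have := mulr_ge0 (sqr_ge0 B) (ltW e0); nra.
pose k : R[i] := (K%:R^-1 : R)%:C.
have H0 : [set m | 0 <= dot v m] 0 by rewrite /= dot0.
have HD a a' : [set m | 0 <= dot v m] a -> [set m | 0 <= dot v m] a' ->
   [set m | 0 <= dot v m] (a + a') by rewrite /= dotD; exact: addr_ge0.
exists (fun z => (1 + k * p z) ^+ K), (fun z => (1 - k * p z) ^+ K); split.
- by apply: tspanX => //; apply: tspanD (tspan_cst _ H0) (tspanZ _ sp).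
- by apply: tspanX => //; apply: tspanB (tspan_cst _ H0) (tspanZ _ sp).
move=> z; set r := complex.Re (p z); set n := normc (p z).
have n0 : 0 <= n := normc_ge0 _.
have nb : n <= b := pb z.
have rn : `|r| <= n := Re_le_normc _.
have nn : n ^+ 2 <= b ^+ 2 by nra.
split.
- have E : normc ((1 + k * p z) ^+ K) ^+ 2 = (1 + (2 * r + n ^+ 2 / K%:R) / K%:R) ^+ K.
    rewrite normcX -exprM mulnC exprM; congr (_ ^+ K).
    rewrite /n !normc_sqrE /r /k; case: (p z) => x y /=.
    by field; rewrite gt_eqF.
  have n1 : n ^+ 2 / K%:R <= n ^+ 2.
    rewrite ler_pdivrMr // ler_peMr ?sqr_ge0 //; nra.
  have n2 : 0 <= n ^+ 2 / K%:R by rewrite divr_ge0 ?sqr_ge0 // ltW.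
  rewrite E; apply: le_trans (exp_limit B1 K0 _ _ K1) _.
  + by rewrite lerDl n2 /= lerD2l ler_pM2r ?invr_gt0 // /B; nra.
  + apply: le_trans (ler_normD _ _) _.
    by rewrite normrM (ger0_norm n2) ger0_norm // /B; nra.
  + apply: le_trans K2; rewrite ler_wpM2r ?divr_ge0 ?mulr_ge0 ?sqr_ge0 ?(ltW KR) //.
    by have := pT z; rewrite -/r; lra.
- rewrite -exprMn.
  (* The first-order terms cancel: f g = (1 - p^2/K^2)^K, whose distance to 1 is at most
     exp(|p|^2/K) - 1. *)
  have -> : (1 + k * p z) * (1 - k * p z) = 1 + (- (k * p z) * (k * p z)) by ring.
  apply: le_trans (normc_exp1_sub1 _ _) _.
  rewrite normcM normcN normcM normc_real ger0_norm ?invr_ge0 ?(ltW KR) // -/n.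
  have y0 : 0 <= K%:R^-1 * n * (K%:R^-1 * n) by rewrite -expr2 sqr_ge0.
  have := @expn_le_expR R (K%:R^-1 * n * (K%:R^-1 * n)) K.
  have -> : K%:R * (K%:R^-1 * n * (K%:R^-1 * n)) = n ^+ 2 / K%:R.
    by field; rewrite gt_eqF.
  have q1 : n ^+ 2 / K%:R <= B ^+ 2 / K%:R.
    by rewrite ler_pM2r ?invr_gt0 //; apply: le_trans BB; rewrite /B; nra.
  have q2 : n ^+ 2 / K%:R <= 1 / 2.
    by apply: le_trans q1 _; rewrite ler_pdivrMr //; lra.
  have q0 : 0 <= n ^+ 2 / K%:R by rewrite divr_ge0 ?sqr_ge0 // ltW.
  have q3 : expR (n ^+ 2 / K%:R) - 1 <= 2 * (n ^+ 2 / K%:R).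
    by apply: expR_sub1_le; rewrite q0.
  rewrite addr_ge0 // => /(_ isT) H.
  rewrite -mulrA in K2; nra.
Qed.

(** With C an upper bound of [t], write t = C (1 - w) where 0 <= w <= 1 - d/C. A Taylor polynomial
    of ln(1 - w) in [w] is a trigonometric polynomial, so ln t is approximated without leaving the
    algebra. *)
Lemma approx_factor v t (d e : R) : tspan setT t -> 0 < d ->
  (forall z, d%:C <= t z) -> 0 < e ->
  exists f g, [/\ tspan [set m | 0 <= dot v m] f, tspan [set m | 0 <= dot v m] g &
    forall z, normc (t z - f z * (f z)^*) <= e /\ normc (f z * g z - 1) <= e].
Proof.
move=> st d0 td e0.
have tE z : t z = (complex.Re (t z))%:C /\ d <= complex.Re (t z).
  have := td z; rewrite lecE /= => /andP[/eqP im ->]; split => //.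
  by apply/eqP; rewrite eq_complex /= im !eqxx.
have [C C0 tC] := tspan_bounded st.
have tC' z : complex.Re (t z) <= C.
  by apply: le_trans (tC z); apply: le_trans (Re_le_normc _); exact: ler_norm.
have dC : d <= C by apply: le_trans (tC' 0); case: (tE 0).
have dC1 : 0 < d / C <= 1 by rewrite divr_gt0 //= ler_pdivrMr // mul1r.
(* An error y <= 1/2 in the logarithm costs at most t |exp(y) - 1| <= 2 C e' <= e/2 in [t]. *)
pose e' := Num.min (1 / 2) (e / (4 * C)).
have e'0 : 0 < e' by rewrite lt_min divr_gt0 //= divr_gt0 //; lra.
have e'1 : e' <= 1 / 2 by rewrite ge_min lexx.
have e'2 : 4 * C * e' <= e.
  have : e' <= e / (4 * C) by rewrite ge_min lexx orbT.
  by rewrite ler_pdivlMr ?mulr_gt0 // mulrC.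
have [K HK] := ln_taylor dC1 e'0.
pose w z : R := 1 - complex.Re (t z) / C.
pose l z := ln C - \sum_(k < K) w z ^+ k.+1 / k.+1%:R.
have le z : `|expR (l z) - complex.Re (t z)| <= e / 2.
  have tz0 : 0 < complex.Re (t z) by case: (tE z) => _; apply: lt_le_trans.
  have wz : 0 <= w z <= 1 - d / C.
    rewrite /w subr_ge0 ler_pdivrMr // mul1r tC' /= lerD2l lerN2.
    by rewrite ler_pM2r ?invr_gt0 //; case: (tE z).
  have := HK _ wz.
  have -> : 1 - w z = complex.Re (t z) / C by rewrite /w; ring.
  rewrite ln_div ?posrE // => H.
  have lE : l z = ln (complex.Re (t z)) + (l z - ln (complex.Re (t z))) by ring.
  rewrite lE expRD lnK ?posrE //.
  set y := l z - _.
  have y1 : `|y| <= e'.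
    rewrite -normrN; apply: le_trans H; rewrite le_eqVlt; apply/orP; left; apply/eqP.
    by congr `|_|; rewrite /y /l; ring.
  have := expR_sub1_norm (le_trans y1 e'1).
  have -> : complex.Re (t z) * expR y - complex.Re (t z) = complex.Re (t z) * (expR y - 1) by ring.
  rewrite normrM gtr0_norm // => H2.
  have : complex.Re (t z) * `|expR y - 1| <= C * (2 * e').
    by apply: ler_pM; rewrite ?normr_ge0 ?(ltW tz0) //; lra.
  lra.
have [p sp pE] : exists2 p, tspan [set m | 0 <= dot v m] p &
    forall z, 2 * complex.Re (p z) = l z.
  (* The real function [l] again, as a complex combination of powers of [t], to which
     [half_real_part] applies. *)
  pose L z : R[i] := (ln C)%:C -
    \sum_(k < K) (k.+1%:R^-1 : R)%:C * (1 - (C^-1)%:C * t z) ^+ k.+1.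
  have sL : tspan setT L.
    apply: tspanB (tspan_cst _ I) _; apply: tspan_sum => k _; apply: tspanZ; apply: tspanX => //.
    by apply: tspanB (tspan_cst _ I) (tspanZ _ st).
  have [p sp pE] := half_real_part v sL; exists p => // z; rewrite pE.
  rewrite /L; under eq_bigr do rewrite (tE z).1 -rmorphM
    -(rmorph1 (real_complex R)) -rmorphB -rmorphXn -rmorphM.
  rewrite -rmorph_sum -rmorphB /= /l; congr (_ - _); apply: eq_bigr => k _.
  by rewrite mulrC /w [_ / C]mulrC.
have [z|f [g [sf sg fg]]] := @exp_factor v p (C + e / 2) (e / 2) sp _ (divr_gt0 e0 (ltr0n _ 2)).
  by rewrite pE; have := le z; have := tC' z; rewrite ler_norml => ? /andP[]; lra.
exists f, g; split => // z; have [H1 H2] := fg z; split; last by lra.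
rewrite -normc_sqr (tE z).1 -rmorphB normc_real.
rewrite pE in H1; have H3 := le z; rewrite distrC.
have -> : normc (f z) ^+ 2 - complex.Re (t z) =
  (normc (f z) ^+ 2 - expR (l z)) + (expR (l z) - complex.Re (t z)) by ring.
apply: le_trans (ler_normD _ _) _; lra.
Qed.

End Factor.

(** * Fourier coefficients *)

Section Fourier.
Variable R : realType.
Implicit Types (m a : int * int) (z : R * R) (v : int * int).
Implicit Types (A B : set (int * int)) (f g h : R * R -> R[i]).

Local Notation mu := (@lebesgue_measure R).
Local Notation I01 := (`[0%R, 1%R]%classic : set R).

(* The real part of a multiple of a character, as a function of one coordinate;
   multiplying the coefficient by i turns it into a derivative. *)
Definition wave (w : R[i]) (A B y : R) : R := complex.Re (w * cis (A + B * y)).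

Lemma waveE w (A B : R) : wave w A B =
  fun y => complex.Re w * cos (A + B * y) - complex.Im w * sin (A + B * y).
Proof. by apply: funext => y; rewrite /wave /cis; case: w. Qed.

Lemma is_derive_affine (A B y : R) : is_derive y 1 (fun y : R => A + B * y) B.
Proof.
have := is_deriveD (is_derive_cst A y 1) (is_deriveZ B (is_derive_id y (1 : R))).
by rewrite add0r /GRing.scale /= mulr1.
Qed.

Lemma is_derive_wave w (A B y : R) : is_derive y 1 (wave w A B) (B * wave ('i%C * w) A B y).
Proof.
rewrite !waveE.
have D := is_derive_affine A B y.
have D1 : is_derive y 1 (cos \o (fun y => A + B * y)) (- sin (A + B * y) * B).
  exact: is_derive1_comp.
have D2 : is_derive y 1 (sin \o (fun y => A + B * y)) (cos (A + B * y) * B).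
  exact: is_derive1_comp.
have := is_deriveB (is_deriveZ (complex.Re w) D1) (is_deriveZ (complex.Im w) D2).
rewrite /GRing.scale /= => D3.
have -> : B * (complex.Re ('i%C * w) * cos (A + B * y) - complex.Im ('i%C * w) * sin (A + B * y)) =
  complex.Re w * (- sin (A + B * y) * B) - complex.Im w * (cos (A + B * y) * B).
  by case: w {D3} => p q /=; ring.
exact: D3.
Qed.

Lemma continuous_wave w (A B : R) : continuous (wave w A B).
Proof.
move=> y; apply/differentiable_continuous/derivable1_diffP.
by apply: ex_derive; exact: is_derive_wave.
Qed.

Lemma integrable_wave w (A B : R) : mu.-integrable I01 (EFin \o wave w A B).
Proof.
apply: continuous_compact_integrable; first exact: segment_compact.
exact/continuous_subspaceT/continuous_wave.
Qed.

Lemma integral_wave w (A : R) (k : int) :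
  \int[mu]_(y in I01) wave w A (2 * pi * k%:~R) y =
  if k == 0 then complex.Re (w * cis A) else 0.
Proof.
case: eqP => [->|/eqP k0].
  have -> : wave w A (2 * pi * 0%:~R) = cst (complex.Re (w * cis A)).
    by apply: funext => y; rewrite /wave mulr0 mul0r addr0.
  by rewrite Rintegral_cst //= lebesgue_measure_itv /= lte01 oppr0 addr0 mulr1.
set B := 2 * pi * k%:~R.
have B0 : B != 0 by rewrite /B !mulf_neq0 ?intr_eq0 // gt_eqF // pi_gt0.
(* Dividing [w] by iB makes [wave u A B] a primitive; it takes equal values at 0 and 1. *)
pose u : R[i] := - 'i%C * w * (B^-1)%:C.
have E y : wave w A B y = B * wave ('i%C * u) A B y.
  rewrite !waveE /u; case: (w) => p q /=; field; exact: B0.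
rewrite /Rintegral (@continuous_FTC2 _ _ (wave u A B)) //=.
- rewrite /wave mulr0 addr0 mulr1 cisD /B cis_int mulr1 subrr //.
- exact/continuous_subspaceT/continuous_wave.
- split => [y _| |]; first by apply: ex_derive; exact: is_derive_wave.
  + exact/cvg_at_right_filter/continuous_wave.
  + exact/cvg_at_left_filter/continuous_wave.
- move=> y _; rewrite derive1E E; exact: (@derive_val _ _ _ _ _ _ _ (is_derive_wave u A B y)).
Qed.

Definition inner f (x : R) : R := \int[mu]_(y in I01) complex.Re (f (x, y)).

Lemma echar_wave c m x y : complex.Re (c * echar m (x, y)) =
  wave c (2 * pi * m.1%:~R * x) (2 * pi * m.2%:~R) y.
Proof. by rewrite /wave echarE; congr (complex.Re (c * cis _)) => /=; ring. Qed.

Lemma Re_echarS c m h x :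
  (fun y => complex.Re (c * echar m (x, y) + h (x, y))) =
  (fun y => wave c (2 * pi * m.1%:~R * x) (2 * pi * m.2%:~R) y + complex.Re (h (x, y))).
Proof. by apply: funext => y; rewrite ReD echar_wave. Qed.

Lemma innerS c m h :
  (forall x, mu.-integrable I01 (EFin \o (fun y => complex.Re (h (x, y))))) ->
  inner (fun z => c * echar m z + h z) =
  (fun x => wave (if m.2 == 0 then c else 0) 0 (2 * pi * m.1%:~R) x + inner h x).
Proof.
move=> ih; apply: funext => x; rewrite /inner Re_echarS.
rewrite RintegralD //; last exact: integrable_wave.
rewrite integral_wave; congr (_ + _).
by case: ifP => _; rewrite /wave ?mul0r // add0r.
Qed.

Lemma integrable_inner A f : tspan A f ->
  (forall x, mu.-integrable I01 (EFin \o (fun y => complex.Re (f (x, y))))) /\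
  mu.-integrable I01 (EFin \o inner f).
Proof.
elim=> [|c m h Am sh [IH1 IH2]].
  have i0 : mu.-integrable I01 (EFin \o cst (0 : R)).
    have := integrable_wave 0 0 0; congr (integrable _ _ (EFin \o _)).
    by apply: funext => y; rewrite /wave mul0r.
  split => //; rewrite (_ : inner _ = cst 0) //; apply: funext => x.
  by rewrite /inner Rintegral_cst // mul0r.
split => [x|].
  rewrite Re_echarS; exact: (integrableD _ (integrable_wave _ _ _) (IH1 x)).
rewrite innerS //.
exact: (integrableD _ (integrable_wave _ _ _) IH2).
Qed.

Lemma Rintegral_innerS A c m h : tspan A h ->
  \int[mu]_(x in I01) inner (fun z => c * echar m z + h z) x =
  (if m == 0 then complex.Re c else 0) + \int[mu]_(x in I01) inner h x.
Proof.
move=> sh; have [IH1 IH2] := integrable_inner sh.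
rewrite innerS //.
rewrite RintegralD //; last exact: integrable_wave.
rewrite integral_wave cis0 mulr1; congr (_ + _).
by case: m => m1 m2 /=; rewrite xpair_eqE; case: (m1 == 0) => //=; case: (m2 == 0).
Qed.

(** Since Im f = Re(-i f), the computation of real parts covers both components. *)
Lemma intT2E f : intT2 f =
  (\int[mu]_(x in I01) inner f x) +i* (\int[mu]_(x in I01) inner (fun z => - 'i%C * f z) x).
Proof.
have -> : inner (fun z => - 'i%C * f z) =
    fun x => \int[mu]_(y in I01) complex.Im (f (x, y)).
  apply: funext => x; apply: eq_Rintegral => y _.
  by case: (f _) => p q /=; ring.
by [].
Qed.

Lemma intT2_0 : intT2 (fun=> 0 : R[i]) = 0.
Proof.
have H g : g =1 (fun=> 0) -> \int[mu]_(x in I01) inner g x = 0.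
  move=> g0; rewrite (_ : inner g = cst 0) ?Rintegral_cst ?mul0r //.
  apply: funext => x; rewrite /inner; under eq_Rintegral do rewrite g0.
  by rewrite Rintegral_cst ?mul0r.
by rewrite intT2E !H // => z; rewrite mulr0.
Qed.

Lemma intT2S A c m h : tspan A h ->
  intT2 (fun z => c * echar m z + h z) = (if m == 0 then c else 0) + intT2 h.
Proof.
move=> sh; rewrite !intT2E (Rintegral_innerS _ _ sh).
rewrite (_ : (fun z => - 'i%C * (c * echar m z + h z)) =
   fun z => (- 'i%C * c) * echar m z + (- 'i%C * h z)); last first.
  by apply: funext => z; rewrite mulrDr mulrA.
rewrite (Rintegral_innerS _ _ (tspanZ _ sh)).
case: (m == 0); last by rewrite !add0r.
by case: c => p q; simpc; congr (_ +i* _); rewrite /=; ring.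
Qed.

Lemma fourierS A c a f m : tspan A f ->
  fourier (fun z => c * echar a z + f z) m = (if a == m then c else 0) + fourier f m.
Proof.
move=> sf; rewrite /fourier.
have sm : tspan setT (fun z => f z * (echar m z)^*).
  have sc := tspan_conj (B := setT) (fun _ _ => I) (@tspan_echar R setT 1 m I).
  have : tspan setT (fun z => f z * (1 * echar m z)^*) by apply: tspanM sf sc.
  by apply: eq_tspan => z; rewrite mul1r.
rewrite -[a == m]subr_eq0 -(intT2S _ _ sm); congr (intT2 _); apply: funext => z.
by rewrite mulrDl echarD echarN mulrA.
Qed.

Lemma fourier0 m : fourier (fun=> 0 : R[i]) m = 0.
Proof.
by rewrite /fourier -[RHS]intT2_0; congr (intT2 _); apply: funext => z; rewrite mul0r.
Qed.

Lemma fourierD A B f g m : tspan A f -> tspan B g ->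
  fourier (fun z => f z + g z) m = fourier f m + fourier g m.
Proof.
move=> sf sg; elim: sf => [|c a h Aa sh IH].
  rewrite fourier0 add0r; congr (fourier _ m); apply: funext => z; exact: add0r.
rewrite (fourierS _ _ _ sh) -addrA -IH.
have shg : tspan setT (fun z => h z + g z).
  by apply: tspanD; [apply: sub_tspan sh|apply: sub_tspan sg].
rewrite -(fourierS _ _ _ shg); congr (fourier _ m); apply: funext => z; by rewrite addrA.
Qed.

Lemma fourier_tspan A f m : tspan A f -> ~ A m -> fourier f m = 0.
Proof.
move=> sf nA; elim: sf => [|c a h Aa sh IH]; first exact: fourier0.
rewrite (fourierS _ _ _ sh) IH addr0; case: eqP => // E; by rewrite E in Aa.
Qed.

(** In a representation with distinct frequencies the coefficients are the Fourier coefficients, so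
    each term either vanishes or has its frequency in [A]. *)
Lemma tspan_fourier A f : tspan setT f -> (forall m, fourier f m != 0 -> A m) ->
  tspan A f.
Proof.
move=> /tspan_uniq[s [c [us ->]]] H.
have fE m : m \in s -> fourier (fun z => \sum_(m <- s) c m * echar m z) m = c m.
  elim: s us {H} => [//|a s IH] /= /andP[as_ us].
  have ss : tspan [set` s] (fun z => \sum_(m <- s) c m * echar m z).
    by apply: tspan_sum => a' a's; exact: tspan_echar.
  under eq_fun do rewrite big_cons.
  rewrite (fourierS _ _ _ ss) inE => /predU1P[->|ms].
    by rewrite eqxx (fourier_tspan ss) ?addr0 //=; exact/negP.
  rewrite (IH us ms) (_ : (a == m) = false) ?add0r //.
  by apply/negP => /eqP E; rewrite E ms in as_.
apply: tspan_sum => m ms; have [c0|c0] := eqVneq (c m) 0.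
  by rewrite c0; apply: eq_tspan (@tspan0 R A) => z; rewrite mul0r.
by apply: tspan_echar; apply: H; rewrite fE.
Qed.

(** The integral of a trigonometric polynomial equals a finite mean of its values along one
    well-chosen direction, and the bound is clear for a mean. *)
Lemma normc_fourier f m (e : R) : tspan setT f -> (forall z, normc (f z) <= e) ->
  normc (fourier f m) <= e.
Proof.
move=> sf fe; rewrite /fourier.
set h := fun z => _.
have he z : normc (h z) <= e by rewrite /h normcM normc_conj normc_echar mulr1.
have sh : tspan setT h.
  have sc := tspan_conj (B := setT) (fun _ _ => I) (@tspan_echar R setT 1 m I).
  have : tspan setT (fun z => f z * (1 * echar m z)^*) by apply: tspanM sf sc.
  by apply: eq_tspan => z; rewrite mul1r.
have [W1 sh1] := tspan_dot_bounded (1, 0) sh.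
have [W2 sh2] := tspan_dot_bounded (0, 1) sh1.
pose M := (W1 + W1.+1 * W2).+1.
(* The direction v separates 0 from all other frequencies of h. *)
pose v : int * int := (1, W1.+1%:Z).
have hE : \sum_(j < M) h (node v M 0 j) = M%:R * intT2 h.
  elim: sh2 => [|c a g [[_ /= a1] /= a2] sg IH].
    by rewrite intT2_0 mulr0 big1.
  rewrite big_split /= IH (intT2S _ _ sg) mulrDr; congr (_ + _).
  under eq_bigr do rewrite echar_slide.
  have aE : [/\ dot v a = a.1 + W1.+1%:Z * a.2, (`|a.1| <= W1)%N,
      (`|a.2| <= W2)%N & `|(W1.+1%:Z * a.2)%R|%N = (W1.+1 * `|a.2|)%N].
    split; last by rewrite abszM absz_nat.
    - by rewrite /dot /v /= mul1r.
    - by move: a1; rewrite /dot /= mul1r mul0r addr0.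
    - by move: a2; rewrite /dot /= mul1r mul0r add0r.
  have [vE b1 b2 abE] := aE.
  rewrite -mulr_sumr -mulr_sumr sum_cis //; last first.
    rewrite vE /M; have := leq_mul (leqnn W1.+1) b2; rewrite -abE.
    by move: (_ * a.2) (_ * W2)%N b1 => P Q; lia.
  have -> : (dot v a == 0) = (a == 0).
    apply/eqP/eqP => [|->]; last by rewrite dot0.
    rewrite vE => E0.
    (* If a.2 were nonzero, the term (W1 + 1) a.2 would exceed |a.1| <= W1 in size and could not
       cancel it. *)
    have y0 : a.2 = 0.
      apply/eqP; rewrite -absz_eq0 -leqn0 leqNgt; apply/negP => y0.
      have := leq_mul (leqnn W1.+1) y0; rewrite muln1 -abE.
      by move: (_ * a.2) E0 b1 => P; lia.
    by move: E0; rewrite y0 mulr0 addr0; case: (a) y0 => x y /= -> ->.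
  case: eqP => [->|_]; last by rewrite !mulr0.
  by rewrite echar0 mul1r mulrC.
have M0 : 0 < M%:R :> R by rewrite ltr0n.
rewrite -(ler_pM2l M0) -(normc_natl R M) -normcM -hE.
apply: le_trans (le_normc_sum _ _) _.
apply: le_trans (ler_sum _ (fun (j : 'I_M) _ => he (node v M 0 j))) _.
by rewrite sumr_const card_ord normc_natl mulr_natl.
Qed.

End Fourier.

(** * Uniform closure *)

Section Topology.
Variable R : realType.
Implicit Types (f : R * R -> R[i]^o) (S : set (R * R -> R[i]^o)).

Lemma ltc_normc (w : R[i]) (e : R) : (`|w| < e%:C) = (normc w < e).
Proof. by rewrite (_ : `|w| = (normc w)%:C) // ltcR. Qed.

Lemma pos_complexE (e : R[i]) : 0 < e -> 0 < complex.Re e /\ e = (complex.Re e)%:C.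
Proof. by case: e => a b; rewrite ltcE /= => /andP[/eqP -> a0]. Qed.

(** Balls of R[i] have radii in R[i]; a positive one is real by [pos_complexE], which yields the
    usual epsilon form. *)
Lemma closure_uniformP f S :
  closure (S : set {uniform (R * R)%type -> R[i]^o}) (f : {uniform (R * R)%type -> R[i]^o}) <->
  forall e : R, 0 < e -> exists2 s, S s & forall z, normc (f z - s z) <= e.
Proof.
split=> [cl e e0|H B].
- pose E : set (R[i]^o * R[i]^o) := [set xy | ball xy.1 (e%:C : R[i]) xy.2].
  have eC : 0 < e%:C :> R[i] by rewrite ltcR.
  have entE : entourage E by exact: (entourage_ball _ (PosNum eC)).
  have [|s [Ss /= sE]] := cl [set h | forall y, [set: R * R] y -> E (f y, h y)].
    by apply/uniform_nbhs; exists E; split => //.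
  exists s => // z; have := sE z I; rewrite /E /= -ball_normE /= => H.
  by rewrite ltW // -ltc_normc.
- move=> /uniform_nbhs[E [entE EB]].
  move: entE; rewrite -entourage_from_ballE => -[d /= /pos_complexE[d0 dE] dE'].
  have [s Ss sf] := H (complex.Re d / 2) (divr_gt0 d0 (ltr0n _ 2)).
  exists s; split => //; apply: EB => y _ /=; apply: dE' => /=.
  rewrite -ball_normE /= dE ltc_normc; apply: le_lt_trans (sf y) _; lra.
Qed.

Lemma continuous_cis_affine (a b : R) :
  continuous (fun z : R * R => cis (2 * pi * (a * z.1 + b * z.2)) : R[i]^o).
Proof.
move=> z; pose th (z : R * R) : R := 2 * pi * (a * z.1 + b * z.2).
have cth : {for z, continuous th}.
  apply: cvgM; first exact: cvg_cst.
  apply: cvgD; apply: cvgM; try exact: cvg_cst; [exact: cvg_fst|exact: cvg_snd].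
have ccos : {for z, continuous (cos \o th)}.
  by apply: continuous_comp cth _; exact: continuous_cos.
have csin : {for z, continuous (sin \o th)}.
  by apply: continuous_comp cth _; exact: continuous_sin.
apply/cvgrPdist_lt => e /pos_complexE[e0 ->].
have e2 : 0 < complex.Re e / 2 by rewrite divr_gt0.
near=> y; rewrite ltc_normc.
have -> : cis (2 * pi * (a * z.1 + b * z.2)) - cis (2 * pi * (a * y.1 + b * y.2)) =
  ((cos \o th) z - (cos \o th) y)%:C + 'i%C * ((sin \o th) z - (sin \o th) y)%:C.
  by rewrite /cis /th; simpc.
apply: le_lt_trans (le_normcD _ _) _.
have -> : normc ('i%C * ((sin \o th) z - (sin \o th) y)%:C) = `|(sin \o th) z - (sin \o th) y|.
  rewrite normcM normc_real (_ : normc 'i%C = 1) ?mul1r //.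
  by rewrite /= expr0n expr1n add0r sqrtr1.
rewrite normc_real [ltRHS]splitr ltrD //.
  by near: y; move/cvgrPdist_lt : ccos; apply.
by near: y; move/cvgrPdist_lt : csin; apply.
Unshelve. all: by end_near. Qed.

Lemma continuous_tspan A f : tspan A f -> continuous f.
Proof.
elim=> [|c m h _ _ IH]; first exact: cst_continuous.
move=> z; apply: (@continuousD _ (R[i]^o)) (IH z).
apply: (@continuousM R[i]); first exact: cst_continuous.
exact: continuous_cis_affine.
Qed.

Lemma periodic_tspan A f : tspan A f -> periodic2 f.
Proof.
elim=> [|c m h _ _ IH] x y j k //; rewrite IH; congr (c * _ + _).
have -> : (x + j%:~R, y + k%:~R) = slide (j, k) (x, y) 1 by rewrite /slide !mulr1.
by rewrite echar_slide mulr1 cis_int mulr1.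
Qed.

Lemma T2P (F : set (int * int)) f : @T2 R F f <-> tspan F f.
Proof.
split=> [[/trigpolyP sf fF]|sf]; first by apply: tspan_fourier => // m; exact: fF.
split; first by apply/trigpolyP; exact: sub_tspan sf.
move=> m /= /eqP fm; apply: contrapT => nF; exact: fm (fourier_tspan sf nF).
Qed.

End Topology.

(** * Property A of strips *)

Section PropertyA.
Variable R : realType.
Implicit Types (F : set (int * int)) (f t : R * R -> R[i]^o) (v m : int * int).

(** Each |s|^2 is nonnegative with frequencies in F - F; nonnegativity and the vanishing of a
    Fourier coefficient both survive uniform limits. *)
Lemma U2_T2p F t : @U2 R F t -> T2p (diffset F) t.
Proof.
move=> [/trigpolyP st [_ /closure_uniformP cl]].
have S2E e : 0 < e -> exists2 s, tspan (diffset F) s &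
    forall z, (0 <= s z) /\ normc (t z - s z) <= e.
  move=> e0; have [_ [s /T2P ss <-] H] := cl _ e0.
  exists (fun z => s z * (s z)^*).
    apply: tspanM ss (tspan_conj (B := [set - b | b in F]) _ ss) => [a _ Fa [b Fb <-]|b Fb].
      by exists a => //; exists b.
    by exists b.
  by move=> z; rewrite -normCK exprn_ge0.
split; last first.
  move=> z; rewrite lecE /=; apply/andP; split.
    apply/eqP/normr0_eq0/eqP; rewrite eq_le normr_ge0 andbT.
    apply/ler_addgt0Pl => e /S2E[s _ /(_ z)[s0]]; rewrite addr0; apply: le_trans.
    have -> : complex.Im (t z) = complex.Im (t z - s z).
      move: s0; rewrite lecE /= => /andP[/eqP].
      by case: (s z) => a b /= -> _; case: (t z) => c d /=; rewrite subr0.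
    rewrite -ler_sqr ?nnegrE ?normc_ge0 // real_normK ?num_real // normc_sqrE.
    by rewrite lerDr sqr_ge0.
  apply/ler_addgt0Pl => e /S2E[s _ /(_ z)[s0 H]].
  have := le_trans (Re_le_normc _) H; rewrite ler_norml => /andP[].
  move: s0; rewrite lecE /= => /andP[_].
  by case: (s z) => a b /=; case: (t z) => c d /=; lra.
apply/T2P; apply: tspan_fourier => // m; apply: contraPP => nF; apply/negP; rewrite negbK.
apply/eqP/eq0_normc/eqP; rewrite eq_le normc_ge0 andbT.
apply/ler_addgt0Pl => e /S2E[s ss H]; rewrite addr0.
have ss' : tspan setT s by apply: sub_tspan ss.
(* For [m] outside F - F the coefficient of [s] is zero, so that of [t] is bounded by the uniform
   distance. *)
have -> : fourier t m = fourier (fun z => t z - s z) m.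
  have := fourierD m (tspanB st ss') ss'; rewrite (fourier_tspan ss nF) addr0 => <-.
  by congr (fourier _ m); apply: funext => z; rewrite subrK.
by apply: normc_fourier; [exact: tspanB|move=> z; case: (H z)].
Qed.

Lemma approx_square v (n : nat) t (e : R) :
  tspan [set m | (`|dot v m| <= n)%N] t -> (forall z, 0 <= t z) -> 0 < e ->
  exists2 s, tspan [set m | 0 <= dot v m <= n%:Z] s &
    forall z, normc (t z - s z * (s z)^*) <= e.
Proof.
move=> st t0 e0.
pose d := e / 2; have d0 : 0 < d by rewrite divr_gt0.
pose t' z := t z + d%:C.
have st' : tspan [set m | (`|dot v m| <= n)%N] t'.
  by apply: tspanD st (tspan_cst _ _); rewrite /= dot0.
have t'd z : d%:C <= t' z by rewrite lerDr.
have [T T0 t'T] := tspan_bounded st'.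
(* [C] bounds |f|^2, hence |f|. As |f|^2 >= d/2 and |f g| <= 2, one has |g|^2 <= 8/d, hence |g| <=
   G. *)
pose C := T + 1; pose G := 8 / d + 1.
have G0 : 0 < 8 / d by rewrite divr_gt0.
pose C1 := C + G.
(* For eta <= 1 the error given by [truncation] with C1 eta and eta is at most K eta. *)
pose K := n.*2.+1%:R * (1 + 2 * C * C1 + C1 ^+ 2).
have C0 : 1 < C by rewrite /C; lra.
have C10 : 1 < C1 by rewrite /C1 /G; lra.
have K0 : 0 < K by rewrite mulr_gt0 ?ltr0n //; nra.
pose eta := Num.min 1 (Num.min (d / 2) (d / K)).
have eta0 : 0 < eta by rewrite !lt_min ltr01 !divr_gt0.
have eta1 : eta <= 1 by rewrite ge_min lexx.
have etad : eta <= d / 2 by rewrite !ge_min lexx orbT.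
have etaK : eta * K <= d.
  by rewrite -ler_pdivlMr // !ge_min lexx !orbT.
have [f [g [sf sg fg]]] := approx_factor v (sub_tspan (fun _ _ => I) st') d0 t'd eta0.
have fC z : normc (f z) ^+ 2 <= C.
  have [H _] := fg z.
  have -> : normc (f z) ^+ 2 = normc (f z * (f z)^*) by rewrite normcM normc_conj.
  have -> : f z * (f z)^* = t' z + - (t' z - f z * (f z)^*) by ring.
  apply: le_trans (le_normcD _ _) _; rewrite normcN /C.
  by have := t'T z; lra.
have fC' z : normc (f z) <= C by have := fC z; have := normc_ge0 (f z); nra.
have fd z : d / 2 <= normc (f z) ^+ 2.
  have [H _] := fg z.
  have -> : normc (f z) ^+ 2 = complex.Re (f z * (f z)^*) by rewrite -normc_sqr.
  have := le_trans (Re_le_normc _) H; rewrite ler_norml => /andP[_].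
  have := t'd z; rewrite lecE => /andP[_] /=.
  move: (f z * _) => w; case: w => a b; case: (t' z) => a' b' /=; lra.
have gG z : normc (g z) <= G.
  have [_ H] := fg z.
  have fgn : normc (f z) * normc (g z) <= 2.
    rewrite -normcM -[f z * g z](subrK 1).
    apply: le_trans (le_normcD _ _) _; rewrite normc1; lra.
  have fg0 : 0 <= normc (f z) * normc (g z) by rewrite mulr_ge0 ?normc_ge0.
  have H2 : (normc (f z) * normc (g z)) ^+ 2 <= 4 by nra.
  have : d / 2 * normc (g z) ^+ 2 <= 4.
    by apply: le_trans H2; rewrite exprMn ler_wpM2r ?sqr_ge0.
  have dG : d / 2 * (8 / d) = 4 by field; rewrite gt_eqF.
  rewrite -dG ler_pM2l; last by lra.
  rewrite /G; have := normc_ge0 (g z); nra.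
have rE z : normc (f z - t' z * (g z)^*) <= C1 * eta.
  have [H1 H2] := fg z.
  (* Both errors of the factorization appear, multiplied by [f] and conj(g), whence the bound C + G
     = C1. *)
  have -> : f z - t' z * (g z)^* =
     - (f z * (f z * g z - 1)^*) + - ((t' z - f z * (f z)^*) * (g z)^*).
    by rewrite rmorphB rmorphM rmorph1; ring.
  apply: le_trans (le_normcD _ _) _; rewrite !normcN !normcM !normc_conj /C1 mulrDl.
  apply: lerD; last rewrite mulrC; apply: ler_pM; rewrite ?normc_ge0 //.
have C1e : 0 < C1 * eta by rewrite mulr_gt0 //; lra.
have [s ss sE] := truncation st' sf sg C1e fC' rE (fun z => (fg z).1).
exists s => // z.
have -> : t z - s z * (s z)^* = (t' z - s z * (s z)^*) + - d%:C by rewrite /t'; ring.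
apply: le_trans (le_normcD _ _) _; rewrite normcN normc_real gtr0_norm //.
have -> : e = d + d by rewrite /d; lra.
rewrite lerD2r; apply: le_trans (sE z) _; apply: le_trans etaK.
rewrite /K [leRHS]mulrCA ler_wpM2l //.
have : (C1 * eta) ^+ 2 <= C1 ^+ 2 * eta.
  by rewrite exprMn ler_wpM2l ?sqr_ge0 // expr2; nra.
nra.
Qed.

Lemma T2p_U2 v (N : nat) F t : F = [set m | (`|dot v m| <= N)%N] ->
  (exists m, dot v m = N%:Z) -> T2p (diffset F) t -> @U2 R F t.
Proof.
move=> FE [m0 m0N] [/T2P st t0].
split; first by apply/trigpolyP; apply: sub_tspan st.
split; first by split; [exact: periodic_tspan st|exact: continuous_tspan st].
apply/closure_uniformP => e e0.
have st2 : tspan [set m | (`|dot v m| <= N.*2)%N] t.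
  apply: sub_tspan st => _ [a Fa [b Fb <-]]; move: Fa Fb.
  by rewrite FE /= dotB; lia.
have [s ss sE] := approx_square st2 t0 e0.
exists (fun z => s z * (s z)^*) => //.
(* A shift by a frequency with u = -N takes {0 <= u <= 2N} to {|u| <= N} and leaves the modulus
   unchanged. *)
exists (fun z => 1 * echar (- m0) z * s z).
  apply/T2P; apply: (tspanM_echar _ _ ss) => a /=.
  by rewrite FE /= dotD dotN m0N; lia.
apply: funext => z; rewrite mul1r normCK rmorphM /= mulrACA.
by rewrite echarN conjCK [X in X * _]mulrC echarE cis_unit mul1r.
Qed.

(** Bezout: p and q are coprime, so u takes every integer value. *)
Lemma dot_denq_numq (alpha : rat) (N : int) :
  exists m, dot (- numq alpha, denq alpha) m = N.
Proof.
have [u [w E]] := Bezoutz (numq alpha) (denq alpha).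
exists (- N * u, N * w); rewrite /dot /=.
have -> : - numq alpha * (- N * u) + denq alpha * (N * w) =
   N * (u * numq alpha + w * denq alpha) by ring.
have /eqP c := coprime_num_den alpha.
by rewrite E /gcdz c mulr1.
Qed.

Lemma exists_nat_lt (b : R) : 0 < b ->
  exists N : nat, forall k : nat, (k%:R < b) = (k <= N)%N.
Proof.
(* The least such [n] is the largest natural number strictly below [b], also when [b] is an
   integer. *)
move=> b0; have b1 : exists n : nat, b <= n.+1%:R.
  by exists (Num.truncn b); rewrite ltW // truncnS_gt // ltW.
pose N := ex_minn b1; exists N => k.
rewrite /N; case: ex_minnP => n bn nmin; apply/idP/idP => [kb|kn].
  by rewrite -ltnS -(ltr_nat R); apply: lt_le_trans bn.
apply: le_lt_trans (_ : n%:R < b); first by rewrite ler_nat.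
case: n bn nmin kn => [//|n] bn nmin kn; rewrite ltNge; apply/negP => /nmin.
by rewrite ltnn.
Qed.

(** Multiplying |k - j alpha| < beta by q > 0 gives |qk - pj| < q beta, a condition on an integer;
    this is where rationality of alpha enters. *)
Lemma strip_dot (alpha : rat) (beta : R) : 0 < beta ->
  exists N : nat, strip alpha beta =
    [set m | (`|dot (- numq alpha, denq alpha) m| <= N)%N].
Proof.
move=> b0; have q0 : 0 < (denq alpha)%:~R :> R by rewrite ltr0z denq_gt0.
have [N HN] := exists_nat_lt (mulr_gt0 q0 b0); exists N.
apply/funext => -[j k]; apply/propext; rewrite /strip /= -HN.
rewrite -(ltr_pM2l q0) -[X in X * `|_|](gtr0_norm q0) -normrM.
rewrite -[X in X%:R < _]/(absz _) natr_absz.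
have -> : `|dot (- numq alpha, denq alpha) (j, k)|%:~R =
  `|(denq alpha)%:~R * (k%:~R - j%:~R * ratr alpha)| :> R.
  rewrite intr_norm; congr `|_|; rewrite /dot /= intrD !intrM rmorphN /= /ratr.
  by field; rewrite gt_eqF.
by [].
Qed.

End PropertyA.

Theorem theorem3p2 (R : realType) (alpha : rat) (beta : R) (beta_gt0 : 0 < beta) :
  propertyA R (strip alpha beta).
Proof.
have [N FE] := strip_dot alpha beta_gt0.
apply/seteqP; split => t; last exact: U2_T2p.
exact: T2p_U2 FE (dot_denq_numq alpha N).
Qed.
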